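(* Let $(S,U,\mathcal{A},C)$ be a WSP instance in which every constraint in $C$ is user-independent, and suppose that the iterative plan-construction algorithm described in the context considers the users in the order $u_1,u_2,\ldots,u_n$, where $U=\{u_1,\dots,u_n\}$. For each user $u$ considered, let $\Pi_u$ be the set of plans built by the algorithm while processing $u$. Suppose that $\Pi_{u_i}=\emptyset$ for some user $u_i$, $i\ge 1$, and that a user $u_j\in\{u_{i+1},\ldots,u_n\}$ satisfies $A(u_j)\subseteq A(u_i)$. Then $\Pi_{u_j}=\emptyset$.
   Context: **WSP instance.** A workflow (WSP instance) is a tuple $(S,U,\mathcal{A},C)$, where $S=\{s_1,\dots,s_k\}$ is a finite (ordered) set of steps, $U$ is a finite set of $n$ users, $\mathcal{A}=\{A(u):u\in U\}$ with $A(u)\subseteq S$ the set of steps user $u$ is authorized to perform, and $C$ is a finite set of constraints. A constraint is a pair $(Q,\Theta)$ with scope $Q\subseteq S$ and $\Theta$ a set of functions $Q\to U$. It is user-independent if for every $\theta\in\Theta$ and every permutation $\phi:U\to U$ we have $\phi\circ\theta\in\Theta$. **Plans.** A partial plan is a function $\pi:T\to Y$ with $T\subseteq S$, $Y\subseteq U$ (viewed as a $U$-valued function on $T$). It is complete if $T=S$. It is authorized if $s\in A(\pi(s))$ for all $s\in T$. It is eligible if it violates no constraint in $C$, i.e. $\pi|_Q\in\Theta$ for every $(Q,\Theta)\in C$ with $Q\subseteq T$. It is valid if it is both authorized and eligible. **Equivalence and patterns.** Partial plans $\pi:T\to Y$ and $\pi':T'\to Y'$ are equivalent, $\pi\approx\pi'$,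 iff $T=T'$ and for all $s,t\in T$: $\pi(s)=\pi(t)\Leftrightarrow\pi'(s)=\pi'(t)$. The pattern (encoding) of $\pi:T\to Y$ is $\mathrm{Enc}(\pi)=(T,(x_1,\dots,x_k))$, where, for $i=1,\dots,k$: $x_i=0$ if $s_i\notin T$; $x_1=1$ if $s_1\in T$; for $i>1$ and $s_i\in T$, $x_i=x_j$ if $\pi(s_i)=\pi(s_j)$ for some $j<i$ with $s_j\in T$, and $x_i=\max\{x_1,\dots,x_{i-1}\}+1$ otherwise. Two partial plans have the same pattern iff they are equivalent. **The algorithm.** Initialize $\Pi$ to consist of the empty plan $\emptyset\to\emptyset$, and $P$ to consist of its pattern $(\emptyset,(0,\dots,0))$. Process the users one at a time, in some order $u_1,\dots,u_n$. To process a user $u$: 1. Set $\Pi_u=\emptyset$ and $P_u=\emptyset$. 2. For each pattern $p=(T,(x_1,\dots,x_k))\in P$ and each nonempty $T'\subseteq A(u)\setminus T$ (in any order), let $\pi_p$ be the plan in $\Pi$ with pattern $p$, and let $\pi'=\pi_p\cup(T'\to u)$ be the extension of $\pi_p$ that assigns every step of $T'$ to $u$. If $\pi'$ is eligible: if $T\cup T'=S$, stop and return SATISFIABLE together with $\pi'$; otherwise compute $p'=\mathrm{Enc}(\pi')$ and, if $p'\notin P\cup P_u$, add $\pi'$ to $\Pi_u$ and $p'$ to $P_u$. 3. After all pairs $(p,T')$ have been handled, replace $\Pi$ by $\Pi\cup\Pi_u$ and $P$ by $P\cup P_u$, and go on to the next user. If all users have been processed without stopping, return UNSATISFIABLE.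 Thus $\Pi$ always contains exactly one plan for each pattern in $P$. The statement concerns runs that reach user $u_j$ (i.e. that did not stop while processing an earlier user); $\Pi_u$ denotes the value of this set when the processing of $u$ ends. *)

(* Defs.v *)
From HB Require Import structures.
From mathcomp Require Import all_boot all_fingroup finmap.

Set Implicit Arguments.
Unset Strict Implicit.
Unset Printing Implicit Defensive.

(** The ordered set of steps s_1, ..., s_k is ['I_k]; indices start at 0. *)

(** A constraint is a pair (Q, Theta) of a scope Q and a set Theta of
    functions Q -> U. *)
Definition assignments (k : nat) (U : finType) (Q : {set 'I_k}) : finType :=
  {set {ffun {s : 'I_k | s \in Q} -> U}}.

Definition constraint (k : nat) (U : finType) : finType :=
  {Q : {set 'I_k} & assignments U Q}.

Definition scope (k : nat) (U : finType) (c : constraint k U) : {set 'I_k} :=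
  tag c.

Definition allowed (k : nat) (U : finType) (c : constraint k U) :
    {set {ffun {s : 'I_k | s \in scope c} -> U}} :=
  tagged c.

Definition user_independent (k : nat) (U : finType) (c : constraint k U) :
    Prop :=
  forall theta, theta \in allowed c ->
  forall phi : {perm U}, [ffun s => phi (theta s)] \in allowed c.

(** A partial plan pi : T -> Y is encoded by the function equal to [Some (pi s)]
    on T and to [None] outside T. *)
Definition plan (k : nat) (U : finType) : finType := {ffun 'I_k -> option U}.

Definition dom (k : nat) (U : finType) (pi : plan k U) : {set 'I_k} :=
  [set s | pi s != None].

Definition empty_plan (k : nat) (U : finType) : plan k U := [ffun=> None].

(** pi |_ Q belongs to Theta; meant for Q \subset dom pi. *)
Definition satisfies (k : nat) (U : finType) (pi : plan k U)
    (c : constraint k U) : bool :=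
  [exists theta in allowed c, forall s, pi (val s) == Some (theta s)].

Definition eligible (k : nat) (U : finType) (C : {set constraint k U})
    (pi : plan k U) : bool :=
  [forall c in C, (scope c \subset dom pi) ==> satisfies pi c].

(** The union of pi and T' -> u; meant for T' disjoint from dom pi. *)
Definition extend (k : nat) (U : finType) (pi : plan k U) (T' : {set 'I_k})
    (u : U) : plan k U :=
  [ffun s => if s \in T' then Some u else pi s].

Definition pattern (k : nat) : choiceType :=
  ({set 'I_k} * {ffun 'I_k -> nat})%type.

(** The entry x_i, given the list xs of all previous entries.  Since [\max] is 0
    on the empty list, the first entry is 1 when the first step is in T.  All j
    admitted by [pick] have the same entry. *)
Definition next_entry (k : nat) (U : finType) (pi : plan k U) (xs : seq nat)
    (i : 'I_k) : nat :=
  if pi i == None then 0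
  else if [pick j : 'I_k | (j < i) && (pi j == pi i)] is Some j
  then nth 0 xs j
  else (\max_(x <- xs) x).+1.

Definition entries (k : nat) (U : finType) (pi : plan k U) : seq nat :=
  foldl (fun xs i => rcons xs (next_entry pi xs i)) [::] (enum 'I_k).

Definition Enc (k : nat) (U : finType) (pi : plan k U) : pattern k :=
  (dom pi, [ffun i : 'I_k => nth 0 (entries pi) i]).

(** The variables of the processing of one user u: the set Pi_u, the set P_u,
    and, once the algorithm has returned SATISFIABLE, the plan returned. *)
Record round (k : nat) (U : finType) := Round {
  new_plans : {set plan k U};
  new_patterns : {fset pattern k};
  answer : option (plan k U)
}.

Definition empty_round (k : nat) (U : finType) : round k U :=
  Round set0 fset0 None.

(** The treatment of one pair (p, T').  Nothing happens any more once the
    algorithm has stopped.  In the states that the algorithm reaches, [Pi]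
    contains exactly one plan with pattern p, so the [None] branch of [pick] is
    not taken and [pick] involves no choice. *)
Definition handle (k : nat) (U : finType) (C : {set constraint k U})
    (Pi : {set plan k U}) (P : {fset pattern k}) (u : U)
    (r : round k U) (pT : pattern k * {set 'I_k}) : round k U :=
  let: (p, T') := pT in
  if answer r is Some _ then r
  else if [pick pi in Pi | Enc pi == p] is Some pi_p then
    let pi' := extend pi_p T' u in
    if ~~ eligible C pi' then r
    else if p.1 :|: T' == [set: 'I_k] then
      Round (new_plans r) (new_patterns r) (Some pi')
    else if Enc pi' \in (P `|` new_patterns r)%fset then r
    else Round (pi' |: new_plans r) (Enc pi' |` new_patterns r)%fset None
  else r.

(** [prs] lists all pairs (p, T') to be handled for u, once each, in some
    order. *)
Definition pairs_order (k : nat) (U : finType) (A : U -> {set 'I_k})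
    (P : {fset pattern k}) (u : U) (prs : seq (pattern k * {set 'I_k})) :
    Prop :=
  uniq prs /\
  forall (p : pattern k) (T' : {set 'I_k}),
    ((p, T') \in prs) = [&& p \in P, T' != set0 & T' \subset A u :\: p.1].

(** [r] is the result of processing u from the sets [Pi] and [P], for some
    order of the pairs. *)
Definition processed (k : nat) (U : finType) (A : U -> {set 'I_k})
    (C : {set constraint k U}) (Pi : {set plan k U}) (P : {fset pattern k})
    (u : U) (r : round k U) : Prop :=
  exists2 prs, pairs_order A P u prs
    & r = foldl (handle C Pi P u) (empty_round k U) prs.

(** [run_from A C Pi P us rs]: the algorithm, started from [Pi] and [P] with the
    users [us] still to be considered in this order, has a run in which [rs]
    lists the final values of the successive rounds.  The run ends with the first
    round that stops, so the users reached are those at positions smaller than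
    [size rs]. *)
Inductive run_from (k : nat) (U : finType) (A : U -> {set 'I_k})
    (C : {set constraint k U}) :
    {set plan k U} -> {fset pattern k} -> seq U -> seq (round k U) -> Prop :=
| run_unsat Pi P : run_from A C Pi P [::] [::]
| run_sat Pi P u us r :
    processed A C Pi P u r -> answer r <> None ->
    run_from A C Pi P (u :: us) [:: r]
| run_next Pi P u us r rs :
    processed A C Pi P u r -> answer r = None ->
    run_from A C (Pi :|: new_plans r) (P `|` new_patterns r)%fset us rs ->
    run_from A C Pi P (u :: us) (r :: rs).

Definition run (k : nat) (U : finType) (A : U -> {set 'I_k})
    (C : {set constraint k U}) (us : seq U) (rs : seq (round k U)) : Prop :=
  run_from A C [set empty_plan k U] [fset (set0, [ffun=> 0]) : pattern k]%fset
    us rs.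

(* Main.v *)
(** Write P_a for the patterns known once u_1, ..., u_a have been processed
    without stopping.  If every authorized eligible plan with users in a set V
    has its pattern in P_(a-1), then processing u_a puts into P_a the pattern of
    every authorized eligible plan with users in V together with w, for any w
    with A(w) a subset of A(u_a): remove the steps of w, take the representative
    of the remaining pattern, and let u_a, who is fresh there, play the part
    of w.  If u_i adds nothing then P_i = P_(i-1), so u_i may be used twice in
    this argument, first with w = u_j and then with w = u_i.  Hence the patterns
    known after u_i already account for u_j, this persists until u_j is reached,
    and then u_j has nothing to add. *)
Require Import Defs.
From HB Require Import structures.
From mathcomp Require Import all_boot all_fingroup finmap.
(* Again, since fingroup also defines [dom]. *)
Import Defs.

Set Implicit Arguments.
Unset Strict Implicit.
Unset Printing Implicit Defensive.

(** * Patterns as complete invariants of equivalence *)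

Section Plans.

Variables (k : nat) (U : finType).
Implicit Types (pi rho sigma : plan k U) (T : {set 'I_k}) (u v w : U).

(** The kernels are compared on all steps, [None] counting as a value; for equal domains this
    amounts to comparing them on the common domain. *)
Definition equivalent pi rho : Prop :=
  dom pi = dom rho /\ forall s t, (pi s == pi t) = (rho s == rho t).

Lemma equivalent_sym pi rho : equivalent pi rho -> equivalent rho pi.
Proof. by case=> eq_dom eq_ker; split. Qed.

Lemma equivalent_None pi rho s :
  equivalent pi rho -> (pi s == None) = (rho s == None).
Proof.
case=> /setP/(_ s); rewrite !inE => eq_dom _.
by rewrite -[LHS]negbK eq_dom negbK.
Qed.

Lemma next_entry_equivalent pi rho xs i :
  equivalent pi rho -> next_entry pi xs i = next_entry rho xs i.
Proof.
move=> eqv; rewrite /next_entry (equivalent_None i eqv).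
case: ifP => // _; congr (if _ is Some j then _ else _).
by apply: eq_pick => j; rewrite eqv.2.
Qed.

Lemma Enc_equivalent pi rho : equivalent pi rho -> Enc pi = Enc rho.
Proof.
move=> eqv; rewrite /Enc eqv.1; congr (_, _).
apply/ffunP => i; rewrite !ffunE /entries; congr (nth 0 _ i).
elim: (enum 'I_k) [::] => //= j l IHl xs.
by rewrite (next_entry_equivalent _ _ eqv) IHl.
Qed.

Definition prefix_entries pi m : seq nat :=
  foldl (fun xs i => rcons xs (next_entry pi xs i)) [::] (take m (enum 'I_k)).

Lemma prefix_entriesS pi (i : 'I_k) :
  prefix_entries pi i.+1 =
  rcons (prefix_entries pi i) (next_entry pi (prefix_entries pi i) i).
Proof.
by rewrite /prefix_entries (take_nth i) ?size_enum_ord // foldl_rcons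
  nth_ord_enum.
Qed.

Lemma entriesE pi : entries pi = prefix_entries pi k.
Proof. by rewrite /prefix_entries take_oversize // size_enum_ord. Qed.

Lemma size_prefix_entries pi m : m <= k -> size (prefix_entries pi m) = m.
Proof.
elim: m => [|m IHm] lt_mk; first by rewrite /prefix_entries take0.
by rewrite (prefix_entriesS pi (Ordinal lt_mk)) size_rcons IHm // ltnW.
Qed.

(** By induction on [m]: the last entry is either copied from an earlier step with the same user, or
    larger than every earlier entry. *)
Lemma prefix_entries_inj pi m (s t : 'I_k) : m <= k -> s < m -> t < m ->
  s \in dom pi -> t \in dom pi ->
  (nth 0 (prefix_entries pi m) s == nth 0 (prefix_entries pi m) t) =
  (pi s == pi t).
Proof.
elim: m s t => // m IHm s t lt_mk.
pose i := Ordinal lt_mk; rewrite (prefix_entriesS pi i) /=.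
set xs := prefix_entries pi m; set e := next_entry _ _ _.
have szxs : size xs = m by rewrite size_prefix_entries // ltnW.
have step (r : 'I_k) : i \in dom pi -> r \in dom pi -> r < m ->
    (nth 0 xs r == e) = (pi r == pi i).
  rewrite !inE => i_dom r_dom lt_rm; rewrite /e /next_entry (negPf i_dom).
  case: pickP => [j /andP[lt_ji /eqP pi_ji]|no_j].
    rewrite -pi_ji IHm ?(ltnW lt_mk) ?inE //.
    by rewrite pi_ji.
  (* No earlier step shares the user of [i], so [e] is the maximum plus one and lies strictly above
     the entry of [r]. *)
  have := no_j r; rewrite lt_rm /= => ->.
  apply/negbTE; rewrite neq_ltn ltnS; apply/orP; left.
  by apply: (@leq_bigmax_seq _ _ xpredT id) => //; rewrite mem_nth // szxs.
rewrite !nth_rcons szxs !ltnS => le_sm le_tm s_dom t_dom.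
case: (ltngtP s m) le_sm => // [lt_sm|eq_sm] _;
  case: (ltngtP t m) le_tm => // [lt_tm|eq_tm] _.
- by rewrite IHm // ltnW.
- have eti : t = i by apply: val_inj.
  by rewrite eti step // -eti.
- have esi : s = i by apply: val_inj.
  by rewrite eq_sym esi step -?eti // 1?eq_sym -?esi //.
- by rewrite (_ : s = t) ?eqxx //; apply: val_inj; rewrite /= eq_sm.
Qed.

Lemma equivalent_Enc pi rho : Enc pi = Enc rho -> equivalent pi rho.
Proof.
case=> eq_dom /ffunP eq_ent; split=> // s t.
have inj sigma : s \in dom sigma -> t \in dom sigma ->
    (sigma s == sigma t) = (nth 0 (entries sigma) s == nth 0 (entries sigma) t).
  by move=> s_dom t_dom; rewrite entriesE prefix_entries_inj.
have eq_None r : (pi r == None) = (rho r == None).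
  move/setP/(_ r): eq_dom; rewrite !inE => eq_dom.
  by rewrite -[LHS]negbK eq_dom negbK.
(* Entries are compared on assigned steps only; unassigned ones are settled by the equality of
   domains. *)
have [s_None|s_dom] := eqVneq (pi s) None.
  have /eqP -> : rho s == None by rewrite -eq_None s_None.
  by rewrite s_None ![None == _]eq_sym eq_None.
have [t_None|t_dom] := eqVneq (pi t) None.
  have /eqP -> : rho t == None by rewrite -eq_None t_None.
  by rewrite t_None eq_None.
rewrite !inj ?inE -?eq_None //.
by have := eq_ent s; have := eq_ent t; rewrite !ffunE => -> ->.
Qed.

Lemma Enc_empty_plan : Enc (empty_plan k U) = (set0, [ffun=> 0]).
Proof.
rewrite /Enc; congr (_, _); first by apply/setP => s; rewrite !inE ffunE.
apply/ffunP => i; rewrite !ffunE entriesE.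
have: all (pred1 0) (prefix_entries (empty_plan k U) k).
  rewrite /prefix_entries; elim: (take _ _) [::] (erefl : all (pred1 0) [::]).
    by [].
  by move=> j l IHl xs xs0; apply: IHl; rewrite all_rcons xs0 /next_entry ffunE.
move=> /allP/(_ (nth 0 (prefix_entries (empty_plan k U) k) i)) all0.
by apply/eqP/all0/mem_nth; rewrite size_prefix_entries.
Qed.

(** * Eligibility under renaming and removal of users *)

Lemma perm_between (I : eqType) (f g : I -> U) (l : seq I) :
  (forall x y, (f x == f y) = (g x == g y)) ->
  exists phi : {perm U}, {in l, forall x, phi (f x) = g x}.
Proof.
move=> eq_ker; elim: l => [|x l [phi phiE]]; first by exists 1%g.
(* The transposition corrects the value at [x]. For [y] in [l] with [f y] different from [f x], it
   fixes [g y], which differs from [g x] by the equality of kernels and from [phi (f x)] by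
   injectivity. *)
exists (phi * tperm (phi (f x)) (g x))%g => y; rewrite inE permM.
case: (eqVneq (f y) (f x)) => [eq_f _|ne_f].
  rewrite eq_f tpermL; apply/eqP; rewrite eq_sym -eq_ker; exact/eqP.
case/predU1P => [eq_yx|l_y]; first by rewrite eq_yx eqxx in ne_f.
have ne_g : g x != g y by rewrite -eq_ker eq_sym.
by rewrite (phiE y) // tpermD // -(phiE y) // (inj_eq perm_inj) eq_sym.
Qed.

(** On the scope of a constraint the two plans have the same kernel, so a permutation of the users
    carries one restriction to the other. *)
Lemma eligible_equivalent (C : {set constraint k U}) pi rho :
  (forall c, c \in C -> user_independent c) ->
  equivalent pi rho -> eligible C pi -> eligible C rho.
Proof.
move=> C_ui eqv /forall_inP elig; apply/forall_inP => c C_c.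
apply/implyP => sub_rho; have := elig c C_c; rewrite eqv.1 sub_rho /=.
case/exists_inP => theta theta_c /forallP thetaE.
(* The default [theta s] merely supplies a user: the scope lies in the domain of [rho]. *)
pose g s := odflt (theta s) (rho (val s)).
have gE s : rho (val s) = Some (g s).
  rewrite /g; have := subsetP sub_rho _ (valP s); rewrite inE.
  by case: (rho _).
have eq_ker s t : (theta s == theta t) = (g s == g t).
  have := eqv.2 (val s) (val t).
  by rewrite (eqP (thetaE s)) (eqP (thetaE t)) !gE.
have [phi phiE] := perm_between (enum {: {s : 'I_k | s \in scope c}}) eq_ker.
apply/exists_inP; exists [ffun s => phi (theta s)]; first exact: C_ui.
by apply/forallP => s; rewrite ffunE gE phiE // mem_enum.
Qed.

(** Since [u] and [w] are fresh, the block [T] merges with no old block on either side. *)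
Lemma equivalent_extend pi rho T u w :
  (forall s, pi s != Some u) -> (forall s, rho s != Some w) ->
  equivalent pi rho -> equivalent (extend pi T u) (extend rho T w).
Proof.
move=> pi_u rho_w eqv; split.
  apply/setP => s; rewrite !inE !ffunE; case: ifP => // _.
  by rewrite (equivalent_None s eqv).
move=> s t; rewrite !ffunE; case: ifP => _; case: ifP => _.
- by rewrite !eqxx.
- by rewrite eq_sym (negPf (pi_u t)) eq_sym (negPf (rho_w t)).
- by rewrite (negPf (pi_u s)) (negPf (rho_w s)).
- exact: eqv.2.
Qed.

Definition unassign pi w : plan k U :=
  [ffun s => if pi s == Some w then None else pi s].

Lemma unassign_neq pi w s : unassign pi w s != Some w.
Proof. by rewrite ffunE; case: ifP => // ->. Qed.

Lemma extend_unassign pi w :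
  extend (unassign pi w) [set s | pi s == Some w] w = pi.
Proof.
by apply/ffunP => s; rewrite !ffunE inE; case: eqP => [->|].
Qed.

(** A constraint tested on the smaller plan has no step of [w] in its scope, and there both plans
    agree. *)
Lemma eligible_unassign (C : {set constraint k U}) pi w :
  eligible C pi -> eligible C (unassign pi w).
Proof.
move=> /forall_inP elig; apply/forall_inP => c C_c; apply/implyP => sub_c.
have agree s : s \in scope c -> pi s = unassign pi w s /\ s \in dom pi.
  move=> /(subsetP sub_c); rewrite !inE ffunE.
  by case: ifP => //.
have sub_pi : scope c \subset dom pi by apply/subsetP => s /agree[].
have := elig c C_c; rewrite sub_pi /=.
case/exists_inP => theta theta_c /forallP thE.
apply/exists_inP; exists theta => //; apply/forallP => s.
by rewrite -(agree _ (valP s)).1.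
Qed.

End Plans.

(** * What a single round guarantees *)

Section Algorithm.

Variables (k : nat) (U : finType) (A : U -> {set 'I_k}).
Variable C : {set constraint k U}.
Implicit Types (pi rho sigma : plan k U) (T : {set 'I_k}) (u v w : U).
Implicit Types (D V : {set U}) (Pi : {set plan k U}) (P : {fset pattern k}).
Implicit Types (us : seq U) (rs : seq (round k U)).

Lemma processed_sound Pi P u r :
  processed A C Pi P u r ->
  (forall pi', pi' \in new_plans r -> exists pi T,
    [/\ pi \in Pi, T \subset A u :\: dom pi,
        pi' = extend pi T u, eligible C pi' & Enc pi' \notin P]) /\
  (forall p, p \in new_patterns r ->
    exists2 pi, pi \in new_plans r & Enc pi = p).
Proof.
case=> prs [_ prsE] ->.
(* Separates the prefix under induction from the full list, to which [prsE] keeps referring. *)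
have: {subset prs <= prs} by [].
elim/last_ind: {-2}prs => [_|l [p T] IHl sub_l].
  by split=> x; rewrite ?in_set0 ?in_fset0.
have [|sound repr] := IHl _.
  by move=> x l_x; apply: sub_l; rewrite mem_rcons inE l_x orbT.
have lpT : (p, T) \in prs by apply: sub_l; rewrite mem_rcons mem_head.
rewrite foldl_rcons; set r' := foldl _ _ _ in sound repr *.
rewrite /handle; case: (answer r') => [_|]; first by split.
case: pickP => [pi /andP[Pi_pi /eqP Enc_pi]|_]; last by split.
case: ifP => [_|/negbFE elig]; first by split.
case: ifP => [_|_]; first by split.
case: ifP => [_|]; first by split.
rewrite in_fsetU => /negbT; rewrite negb_or => /andP[new _].
split=> [pi' /setU1P[->|/sound //]|p'].
  exists pi, T; split=> //.
  by have := lpT; rewrite prsE -Enc_pi => /and3P[].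
case/fset1UP => [->|/repr[pi' r_pi' <-]].
  by exists (extend pi T u); rewrite ?setU11.
by exists pi'; rewrite // setU1r.
Qed.

Lemma foldl_handle_stopped Pi P u r prs :
  answer r <> None -> foldl (handle C Pi P u) r prs = r.
Proof.
move=> stopped; elim: prs => //= -[p T] prs IHprs.
by rewrite /handle; case: (answer r) stopped.
Qed.

Lemma new_patterns_foldl_handle Pi P u r prs p :
  p \in new_patterns r -> p \in new_patterns (foldl (handle C Pi P u) r prs).
Proof.
elim: prs r => //= -[q T] prs IHprs r r_p; apply: IHprs.
rewrite /handle; case: (answer r) => //; case: pickP => // pi _.
by do 3![case: ifP => // _]; rewrite fset1Ur.
Qed.

Lemma processed_complete Pi P u r p T :
  processed A C Pi P u r -> answer r = None ->
  (exists2 pi, pi \in Pi & Enc pi = p) ->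
  p \in P -> T != set0 -> T \subset A u :\: p.1 ->
  exists pi, [/\ pi \in Pi, Enc pi = p &
    eligible C (extend pi T u) ->
    Enc (extend pi T u) \in (P `|` new_patterns r)%fset].
Proof.
case=> prs [_ prsE] -> going [rho Pi_rho Enc_rho] P_p T_n0 sub_T.
have prs_pT : (p, T) \in prs by rewrite prsE P_p T_n0.
move: going {prsE}; case/splitPr: prs_pT => l l'.
rewrite foldl_cat /=; set r' := foldl _ _ l.
(* A stop before this pair would persist to the end of the round, against [going]. *)
case r'_going: (answer r') => [pi|].
  by rewrite foldl_handle_stopped ?r'_going.
case: pickP => [pi /andP[Pi_pi /eqP Enc_pi]|/(_ rho)]; last first.
  by rewrite Pi_rho Enc_rho eqxx.
move=> going; exists pi; split=> // elig; move: going; rewrite elig /=.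
case: ifP => [_|_]; first by rewrite foldl_handle_stopped.
case: ifP => [|_ _].
  rewrite !in_fsetU => /orP[->//|new _].
  by rewrite new_patterns_foldl_handle ?orbT.
by rewrite in_fsetU new_patterns_foldl_handle ?orbT //= fset1U1.
Qed.

(** * Completeness of the stored patterns *)

Definition authorized_in V pi : Prop :=
  forall s v, pi s = Some v -> v \in V /\ s \in A v.

(** [V] is independent of the users processed so far; below it also contains a user still to
    come. *)
Definition complete V P : Prop :=
  forall pi, authorized_in V pi -> eligible C pi -> Enc pi \in P.

(** Invariant of the state once the users in [D] are processed; it makes every user outside [D]
    fresh for the stored plans. *)
Definition reachable D Pi P : Prop :=
  (forall p, p \in P -> exists2 pi, pi \in Pi & Enc pi = p) /\
  (forall pi, pi \in Pi -> authorized_in D pi).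

Lemma reachable_processed D Pi P u r :
  reachable D Pi P -> processed A C Pi P u r ->
  reachable (u |: D) (Pi :|: new_plans r) (P `|` new_patterns r)%fset.
Proof.
move=> [repr auth] /processed_sound[sound new_repr]; split.
  move=> p; rewrite in_fsetU => /orP[/repr|/new_repr] [pi pi_in <-];
    by exists pi; rewrite // in_setU pi_in ?orbT.
have auth_u pi : pi \in Pi -> authorized_in (u |: D) pi.
  by move=> /auth pi_D s v /pi_D[D_v A_s]; rewrite setU1r.
move=> pi' /setUP[/auth_u //|/sound[pi [T [Pi_pi sub_T -> _ _]]]] s v.
rewrite ffunE; case: ifP => [T_s [<-]|_]; last exact: auth_u.
by rewrite setU11; have := subsetP sub_T s T_s; rewrite inE => /andP[].
Qed.

Hypothesis C_ui : forall c, c \in C -> user_independent c.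

Lemma complete_processed D V Pi P u w r :
  reachable D Pi P -> u \notin D -> complete V P ->
  processed A C Pi P u r -> answer r = None -> A w \subset A u ->
  complete (w |: V) (P `|` new_patterns r)%fset.
Proof.
move=> [repr auth] D'u compl proc going sub_A sigma sigma_auth sigma_elig.
pose tau := unassign sigma w; pose T := [set s | sigma s == Some w].
have P_tau : Enc tau \in P.
  apply: compl; last exact: eligible_unassign.
  move=> s v; rewrite ffunE; case: ifP => // /eqP ne_w sigma_s.
  have [/setU1P[eq_vw|V_v] A_s] := sigma_auth _ _ sigma_s => //.
  by rewrite eq_vw in sigma_s.
(* The algorithm tries nonempty sets only; if [w] has no step, then [sigma] is [tau], whose pattern
   is known. *)
have [T0|T_n0] := eqVneq T set0.
  suff <- : tau = sigma by rewrite in_fsetU P_tau.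
  apply/ffunP => s; rewrite ffunE; case: ifP => // s_w.
  by have := in_set0 s; rewrite -T0 inE s_w.
have sub_T : T \subset A u :\: (Enc tau).1.
  apply/subsetP => s; rewrite !inE ffunE => s_w; rewrite s_w /=.
  by apply: (subsetP sub_A); have [] := sigma_auth _ _ (eqP s_w).
have [rho [Pi_rho Enc_rho]] :=
  processed_complete proc going (repr _ P_tau) P_tau T_n0 sub_T.
have eqv : equivalent (extend rho T u) sigma.
  rewrite -(extend_unassign sigma w); apply: equivalent_extend.
  - move=> s; apply: contra D'u => /eqP/(auth _ Pi_rho)[] //.
  - exact: unassign_neq.
  - exact: equivalent_Enc.
rewrite (Enc_equivalent eqv); apply.
exact: eligible_equivalent C_ui (equivalent_sym eqv) sigma_elig.
Qed.

(** A new plan would be eligible and authorized over [u |: D], so its pattern would already be in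
    [P]. *)
Lemma complete_no_new_plans D Pi P u r :
  reachable D Pi P -> complete (u |: D) P -> processed A C Pi P u r ->
  new_plans r = set0.
Proof.
move=> [_ auth] compl /processed_sound[sound _].
apply/eqP/set0Pn => -[_ /sound[pi [T [Pi_pi sub_T -> elig]]]].
apply/negP; rewrite negbK; apply: compl => // s v.
rewrite ffunE; case: ifP => [T_s [<-]|_ /(auth _ Pi_pi)[D_v A_s]].
  by rewrite setU11; have := subsetP sub_T s T_s; rewrite inE => /andP[].
by rewrite setU1r.
Qed.

Lemma no_new_patterns Pi P u r :
  processed A C Pi P u r -> new_plans r = set0 -> new_patterns r = fset0.
Proof.
move=> /processed_sound[_ repr] r0; apply/fsetP => p; rewrite in_fset0.
by apply/negP => /repr[pi]; rewrite r0 inE.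
Qed.

(** * Propagation along a run *)

Lemma fresh_tail u us D :
  uniq (u :: us) -> {in u :: us, forall v, v \notin D} ->
  uniq us /\ {in us, forall v, v \notin u |: D}.
Proof.
case/andP=> us'u uniq_us us'D; split=> // v us_v; rewrite !inE negb_or.
rewrite us'D ?inE ?us_v ?orbT // andbT.
by apply: contraNneq us'u => <-.
Qed.

Lemma run_from_covered D Pi P us rs w j :
  run_from A C Pi P us rs -> reachable D Pi P -> complete (w |: D) P ->
  uniq us -> {in us, forall v, v \notin D} ->
  j < size rs -> nth w us j = w ->
  new_plans (nth (empty_round k U) rs j) = set0.
Proof.
move=> R; elim: R D j => {Pi P us rs} [//|Pi P u us r proc _|Pi P u us r rs
  proc going _ IH] D [|j] //= reach compl uniq_us fresh //.
(* Here the round of [w] is the one that stops; in the next case it does not. *)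
- move=> _ eq_uw; rewrite -eq_uw in compl.
  exact: complete_no_new_plans reach compl proc.
- move=> _ eq_uw; rewrite -eq_uw in compl.
  exact: complete_no_new_plans reach compl proc.
rewrite ltnS => lt_j us_j.
have [{}uniq_us fresh'] := fresh_tail uniq_us fresh.
have D'u : u \notin D by rewrite fresh ?mem_head.
apply: (IH (u |: D)) lt_j us_j => //.
  exact: reachable_processed reach proc.
(* The user [u] plays its own part, with [w |: D] as the set [V]. *)
by rewrite setUCA; apply: complete_processed reach D'u compl proc going _.
Qed.

Lemma run_from_dominated D Pi P us rs u0 i j :
  run_from A C Pi P us rs -> reachable D Pi P -> complete D P ->
  uniq us -> {in us, forall v, v \notin D} ->
  i < j -> j < size rs -> new_plans (nth (empty_round k U) rs i) = set0 ->
  j < size us -> A (nth u0 us j) \subset A (nth u0 us i) ->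
  new_plans (nth (empty_round k U) rs j) = set0.
Proof.
move=> R; elim: R D i j => {Pi P us rs} [//|Pi P u us r proc _|Pi P u us r rs
  proc going R IH] D i [|j] //= reach compl uniq_us fresh lt_ij lt_j //.
have D'u : u \notin D by rewrite fresh ?mem_head.
have reach' := reachable_processed reach proc.
have [uniq_us' fresh'] := fresh_tail uniq_us fresh.
case: i lt_ij => [_|i lt_ij] /= new0 lt_j_us sub_A; last first.
  apply: (IH (u |: D) i) => //.
  exact: complete_processed reach D'u compl proc going (subxx _).
set w := nth u0 us j in sub_A.
apply: (run_from_covered (w := w) R reach') => //.
  have P_stable : (P `|` new_patterns r)%fset = P.
    by rewrite (no_new_patterns proc new0) fsetU0.
  (* The same round is used twice: first [u] stands in for [w], then, as [P] has not grown, for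
     itself. *)
  have compl_w : complete (w |: D) P.
    rewrite -P_stable.
    exact: complete_processed reach D'u compl proc going sub_A.
  rewrite setUCA.
  exact: complete_processed reach D'u compl_w proc going (subxx _).
exact: set_nth_default.
Qed.

End Algorithm.

Theorem theorem1 (k n : nat) (U : finType) (A : U -> {set 'I_k})
    (C : {set constraint k U})
    (C_ui : forall c, c \in C -> user_independent c)
    (u : 'I_n -> U) (u_bij : bijective u)
    (rs : seq (round k U)) (rs_run : run A C (codom u) rs)
    (i j : 'I_n) (lt_ij : i < j) (reach_j : j < size rs)
    (Pi_i_empty : new_plans (nth (empty_round k U) rs i) = set0)
    (sub_A : A (u j) \subset A (u i)) :
  new_plans (nth (empty_round k U) rs j) = set0.
Proof.
have nth_u (l : 'I_n) : nth (u i) (codom u) l = u l.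
  by rewrite codomE (nth_map l) ?size_enum_ord // nth_ord_enum.
apply: (run_from_dominated (D := set0) (u0 := u i) C_ui rs_run _ _ _ _
  lt_ij reach_j Pi_i_empty).
- split=> [p /fset1P ->|pi /set1P -> s v]; last by rewrite ffunE.
  by exists (empty_plan k U); rewrite ?set11 ?Enc_empty_plan.
(* Over no users only the empty plan is authorized, and its pattern is the initial one. *)
- move=> pi auth _; suff -> : pi = empty_plan k U.
    by rewrite Enc_empty_plan fset11.
  apply/ffunP => s; rewrite ffunE; case pi_s: (pi s) => [v|] //.
  by have [] := auth s v pi_s; rewrite inE.
- by rewrite map_inj_uniq ?enum_uniq //; apply: bij_inj.
- by move=> v _; rewrite inE.
- by rewrite size_codom card_ord.
- by rewrite !nth_u.
Qed.
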